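(* Assume the following condition (A) on data generating processes: (i) for each $t^\ast\in\{0,1\}$, $Z$ is independent of $(R_{t^\ast},T_{t^\ast},Y_{t^\ast},T^\ast_0,T^\ast_1)$; (ii) $T^\ast_1\ge T^\ast_0$ almost surely; (iii) $0<P(Z=0)<1$. Let $P$ be an arbitrary distribution of the observed variables $(R,Y,T,Z)$. Then the sharp identified set $\Theta_I(P)$ for the local average treatment effect is as follows: $\Theta_I(P)=\Theta$ if $TV_{(R,Y,T)}=0$; otherwise $$ \Theta_I(P)=\begin{cases} \left[\Delta E_P[Y\mid Z],\ \dfrac{\Delta E_P[Y\mid Z]}{TV_{(R,Y,T)}}\right] & \text{if }\Delta E_P[Y\mid Z]>0,\\ \{0\} & \text{if }\Delta E_P[Y\mid Z]=0,\\ \left[\dfrac{\Delta E_P[Y\mid Z]}{TV_{(R,Y,T)}},\ \Delta E_P[Y\mid Z]\right] & \text{if }\Delta E_P[Y\mid Z]<0. \end{cases} $$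
   Context: Variables. $Z\in\{0,1\}$ is a binary instrument; $T^\ast_z\in\{0,1\}$ ($z=0,1$) is the counterfactual true treatment when $Z=z$; $Y_{t^\ast}$ (real-valued), $T_{t^\ast}\in\{0,1\}$ and $R_{t^\ast}$ ($t^\ast=0,1$) are the counterfactual outcome, the counterfactual measured treatment and the counterfactual repeated measurement when the true treatment equals $t^\ast$. $R$ need not be binary; it may be discrete or continuous, with dominating measure $\mu_R$. Outcomes have distributions dominated by a known finite measure $\mu_Y$ on the real line. The (unobserved) true treatment is $T^\ast=T^\ast_Z$; the observed variables are $(R,Y,T,Z)$ with $R=R_{T^\ast}$, $Y=Y_{T^\ast}$ and $T=T_{T^\ast}$. A data generating process $P^\ast$ is a joint distribution of $(R_0,R_1,Y_0,Y_1,T_0,T_1,T^\ast_0,T^\ast_1,Z)$; $P^\ast_{(R,Y,T,Z)}$ denotes the distribution of $(R,Y,T,Z)$ it induces. $\mathcal P^\ast$ is the set of all $P^\ast$ satisfying condition (A) of the claim. The distribution $P$ of $(R,Y,T,Z)$ satisfies $0<P(Z=0)<1$, $E_P|Y|<\infty$, and $(R,Y)$ is dominated by $\mu_R\times\mu_Y$. The local average treatment effect is $\theta(P^\ast)=E_{P^\ast}[Y_1-Y_0\mid T^\ast_0<T^\ast_1]$. The parameter space $\Theta$ is the set of all numbers $\int y f_1(y)\,d\mu_Y(y)-\int y f_0(y)\,d\mu_Y(y)$ where $f_0,f_1$ are probability densities with respect to $\mu_Y$ (with finite first moments). The sharp identified set is $$\Theta_I(P)=\{\theta(P^\ast)\in\Theta:\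 P^\ast\in\mathcal P^\ast,\ P^\ast_{(R,Y,T,Z)}=P\}.$$ Convention: if $P^\ast(T^\ast_0<T^\ast_1)=0$, the conditional laws of $Y_1$ and $Y_0$ given the null event $\{T^\ast_0<T^\ast_1\}$ may be specified arbitrarily (with $\mu_Y$-densities), so that $\theta(P^\ast)$ is then allowed to be any element of $\Theta$. Notation: $\Delta E_P[X\mid Z]=E_P[X\mid Z=1]-E_P[X\mid Z=0]$, and $$TV_{(R,Y,T)}=\frac12\sum_{t=0,1}\iint|f_{(R,Y,T)\mid Z=1}(r,y,t)-f_{(R,Y,T)\mid Z=0}(r,y,t)|\,d\mu_R(r)\,d\mu_Y(y),$$ where $f_{(R,Y,T)\mid Z=z}$ is the conditional density of $(R,Y,T)$ given $Z=z$ with respect to $\mu_R\times\mu_Y\times$ counting measure. *)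

(* Defs.v *)
From HB Require Import structures.
From mathcomp Require Import all_boot all_order all_algebra.
From mathcomp Require Import all_classical all_reals all_analysis.

Set Implicit Arguments.
Unset Strict Implicit.
Unset Printing Implicit Defensive.
Import Order.TTheory GRing.Theory Num.Theory.
Import numFieldNormedType.Exports.
Local Open Scope classical_set_scope.
Local Open Scope ring_scope.

(* In a pair indexed by {0, 1}, [false] selects index 0 and [true] index 1. *)
Definition at_ (T : Type) (b : bool) (x : T * T) : T := if b then x.2 else x.1.

(* Values of (R_0,R_1), (Y_0,Y_1), (T_0,T_1), (T*_0,T*_1), Z.  The repeated
   measurement takes its values in an arbitrary measurable space S. *)
Notation latent S R :=
  ((S * S) * (R * R) * (bool * bool) * (bool * bool) * bool)%type.

(* Values of (R, Y, T, Z). *)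
Notation observed S R := (S * R * bool * bool)%type.

Section Variables.
Context {S R : Type}.
Implicit Types (w : latent S R) (o : observed S R) (t z : bool).

Definition R_cf t w : S := at_ t w.1.1.1.1.
Definition Y_cf t w : R := at_ t w.1.1.1.2.
Definition T_cf t w : bool := at_ t w.1.1.2.
Definition Tstar_cf z w : bool := at_ z w.1.2.
Definition Z_lat w : bool := w.2.

Definition Tstar w : bool := Tstar_cf (Z_lat w) w.

Definition obs w : observed S R :=
  (R_cf (Tstar w) w, Y_cf (Tstar w) w, T_cf (Tstar w) w, Z_lat w).

(* {T*_0 < T*_1}, in the order false < true of bool. *)
Definition compliers : set (latent S R) :=
  [set w | (Tstar_cf false w < Tstar_cf true w)%O].

Definition RY_obs o : S * R := o.1.1.
Definition Y_obs o : R := o.1.1.2.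
Definition Z_obs o : bool := o.2.

End Variables.

Definition independent_rv d d1 d2 (Om : measurableType d)
    (U : measurableType d1) (V : measurableType d2) (R : realType)
    (P : probability Om R) (X : Om -> U) (W : Om -> V) : Prop :=
  forall (A : set U) (B : set V), measurable A -> measurable B ->
    (P ((X @^-1` A) `&` (W @^-1` B)) = P (X @^-1` A) * P (W @^-1` B))%E.

(* E[X | C] for an event C of positive probability. *)
Definition cond_mean d (Om : measurableType d) (R : realType)
    (P : probability Om R) (C : set Om) (X : Om -> R) : R :=
  (\int[P]_(w in C) X w) / fine (P C).

Section Model.
Context {R : realType} {d : measure_display} {S : measurableType d}.
Variable muR : {sigma_finite_measure set S -> \bar R}.
Variable muY : {finite_measure set R -> \bar R}.
Implicit Types (Pst : probability (latent S R) R)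
  (P : probability (observed S R) R).

(* Standing assumption on the outcomes: their laws are dominated by muY. *)
Definition dominated_outcomes Pst : Prop :=
  forall t : bool, pushforward Pst (Y_cf t : latent S R -> R) `<< muY.

Definition condition_A Pst : Prop :=
  [/\ forall t : bool,
        independent_rv Pst (Z_lat : latent S R -> bool)
          (fun w : latent S R =>
             (R_cf t w, T_cf t w, Y_cf t w,
              Tstar_cf false w, Tstar_cf true w)),
      {ae Pst, forall w : latent S R,
         (Tstar_cf false w <= Tstar_cf true w)%O} &
      (0 < Pst (Z_lat @^-1` [set false]) < 1)%E].

(* The law P of (R, Y, T, Z) induced by Pst; a probability is only meaningful
   on measurable sets. *)
Definition induces Pst P : Prop :=
  forall A : set (observed S R), measurable A -> P A = pushforward Pst obs A.

Definition density (f : R -> R) : Prop :=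
  [/\ measurable_fun [set: R] f, forall y, 0 <= f y,
      (\int[muY]_y (f y)%:E = 1)%E &
      muY.-integrable [set: R] (fun y => (y * f y)%:E)].

Definition Theta : set R :=
  [set theta | exists f1 f0 : R -> R, [/\ density f1, density f0 &
     theta = \int[muY]_y (y * f1 y) - \int[muY]_y (y * f0 y)]].

(* A relation rather than a function: when the compliers have probability 0,
   the conditional laws of Y_1 and Y_0 given the compliers are arbitrary laws
   with muY-densities, so that every element of Theta is a value of the LATE.
   Integrability says that the conditional expectation exists. *)
Definition is_LATE Pst (theta : R) : Prop :=
  let D : latent S R -> R := fun w => Y_cf true w - Y_cf false w in
  ((0 < Pst compliers)%E ->
     Pst.-integrable compliers (EFin \o D) /\
     theta = cond_mean Pst compliers D) /\
  (Pst compliers = 0%E -> Theta theta).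

Definition identified_set P : set R :=
  [set theta | Theta theta /\
     exists Pst : probability (latent S R) R,
       [/\ dominated_outcomes Pst, condition_A Pst, induces Pst P &
           is_LATE Pst theta]].

Definition DeltaEY P : R :=
  cond_mean P (Z_obs @^-1` [set true]) Y_obs -
  cond_mean P (Z_obs @^-1` [set false]) Y_obs.

(* f is (a version of) the conditional density of (R, Y, T) given Z = z with
   respect to muR x muY x counting measure; the integral against the counting
   measure on {0, 1} is the sum over t. *)
Definition is_cond_density P (z : bool) (f : S * R * bool -> R) : Prop :=
  [/\ measurable_fun [set: S * R * bool] f, forall x, 0 <= f x &
      forall A : set (S * R * bool), measurable A ->
        (P (A `*` [set z]) = P (Z_obs @^-1` [set z]) *
           \sum_(t : bool)
             \int[muR \x muY]_(x in [set x | A (x, t)]) (f (x, t))%:E)%E].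

(* Total variation between the conditional laws with densities f1 (Z = 1) and
   f0 (Z = 0). *)
Definition TV (f1 f0 : S * R * bool -> R) : R :=
  2^-1 * fine (\sum_(t : bool) \int[muY]_y \int[muR]_r
                 `| f1 (r, y, t) - f0 (r, y, t) |%:E)%E.

End Model.

(* Main.v *)
Require Import Defs.
From HB Require Import structures.
From mathcomp Require Import all_boot all_order all_algebra.
From mathcomp Require Import all_classical all_reals all_analysis.
From mathcomp Require Import measurable_realfun ring lra.

Set Implicit Arguments.
Unset Strict Implicit.
Unset Printing Implicit Defensive.
Import Order.TTheory GRing.Theory Num.Theory.
Import numFieldNormedType.Exports.
Local Open Scope classical_set_scope.
Local Open Scope ring_scope.

(** Write X = (R, Y, T) for the observed measurements, X_t for their
    counterfactual value under true treatment t, Q_z for the law of X given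
    Z = z, and c for the probability of compliers.

    Bounds.  By independence, Q_z is the unconditional law of X_{T*_z}
    ([law_X_under]).  By monotonicity T*_1 and T*_0 differ only on compliers,
    where they equal 1 and 0.  Comparing Q_1 and Q_0 on events gives TV <= c
    ([law_gap_le_compliers]), since the total variation is attained on the set
    H where the density for Z = 1 dominates the one for Z = 0
    ([TV_overlap_set]).  Comparing means of Y gives that the integral of
    Y_1 - Y_0 over the compliers is Delta E[Y | Z] ([Rintegral_compliers]), so
    the LATE is Delta E[Y | Z] / c with TV <= c <= 1.  Radon-Nikodym puts this
    value in Theta ([LATE_in_Theta]).

    Sharpness.  For c between TV and 1, the overlap of Q_1 and Q_0, of mass
    1 - TV, can be scaled down to a common part B of mass 1 - c, leaving
    Q_z = A_z + B with A_1 and A_0 of mass c ([overlap_decomposition]).  Let B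
    be the law of never-takers, and draw compliers with X_1 from A_1 and X_0
    from A_0, independently.  This model satisfies the assumptions, induces
    the observed law and has complier probability c ([sharp_model]).  The first
    part computes its LATE, as it does for every admissible model.

    Hence the identified set is {Delta E[Y | Z] / c : TV <= c <= 1} when TV > 0
    ([identified_setE]), which is the stated interval; when TV = 0 the model
    with c = 0 makes every element of Theta admissible. *)

(** * Image measures and integrals *)

Lemma measurable_preimage d1 d2 (U : measurableType d1) (V : measurableType d2)
    (g : U -> V) (A : set V) :
  measurable_fun [set: U] g -> measurable A -> measurable (g @^-1` A).
Proof. by move=> mg mA; rewrite -[X in measurable X]setTI; exact: mg. Qed.

(** The hypothesis [image_mu] covers the three ways in which laws are compared
    below: conditioning on Z, passing to an unconditional law (D = setT,
    k = 1), and conditioning on the compliers. *)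
Section ImageMeasure.
Context d1 d2 (U : measurableType d1) (V : measurableType d2) (R : realType).
Variables (mu : {measure set U -> \bar R}) (nu : {measure set V -> \bar R}).
Variables (D : set U) (phi : U -> V) (k : R).
Hypotheses (mD : measurable D) (mphi : measurable_fun [set: U] phi).
Hypothesis k0 : 0 <= k.
Hypothesis image_mu : forall A, measurable A ->
  (mu (D `&` phi @^-1` A) = k%:E * nu A)%E.

Lemma ge0_integral_mrestr (g : U -> \bar R) :
  measurable_fun [set: U] g -> (forall x, 0 <= g x)%E ->
  (\int[mrestr mu mD]_x g x = \int[mu]_(x in D) g x)%E.
Proof.
move=> mg g0; rewrite -(setvU D) ge0_integral_setU//; last 3 first.
- exact: measurableC.
- exact: measurable_funTS.
- by rewrite disj_set2E setICl.
rewrite [X in (X + _)%E]null_set_integral ?add0e//; last 3 first.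
- exact: measurableC.
- exact: measurable_funTS.
- by rewrite /= /mrestr setICl measure0.
by apply: eq_measure_integral => A mA AD; rewrite /= /mrestr setIidl.
Qed.

Lemma ge0_integral_image (g : V -> \bar R) :
  measurable_fun [set: V] g -> (forall x, 0 <= g x)%E ->
  (\int[mu]_(x in D) g (phi x) = k%:E * \int[nu]_x g x)%E.
Proof.
move=> mg g0.
rewrite -(@ge0_integral_mrestr (g \o phi) (measurableT_comp mg mphi) (fun=> g0 _)).
rewrite -[LHS](@ge0_integral_pushforward _ _ _ _ _ _ mphi
  (mrestr mu mD) setT g)//.
transitivity (\int[mscale (NngNum k0) nu]_x g x)%E.
  apply: eq_measure_integral => A mA _.
  by rewrite /= /pushforward /mrestr setIC image_mu.
by rewrite ge0_integral_mscale.
Qed.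

Lemma integrable_image (g : V -> R) : nu.-integrable [set: V] (EFin \o g) ->
  mu.-integrable D (EFin \o (g \o phi)).
Proof.
move=> /integrableP[mg goo]; apply/integrableP; split.
  by apply: measurable_funTS; exact: (measurableT_comp mg).
rewrite (ge0_integral_image (g := fun y => `|(g y)%:E|%E))//; last first.
  exact: measurableT_comp.
by rewrite lte_mul_pinfty.
Qed.

(** Positivity of [k] matters: for [k = 0] the integral over [D] carries no
    information about [nu]. *)
Lemma integrable_of_image (g : V -> R) : 0 < k ->
  measurable_fun [set: V] g ->
  mu.-integrable D (EFin \o (g \o phi)) -> nu.-integrable [set: V] (EFin \o g).
Proof.
move=> kp mg /integrableP[_ goo]; apply/integrableP.
split; first exact/measurable_EFinP.
move: goo; rewrite (ge0_integral_image (g := fun y => `|(g y)%:E|%E))//; last first.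
  by apply: measurableT_comp => //; exact/measurable_EFinP.
rewrite !ltNge; apply: contra; rewrite !leye_eq => /eqP ->.
by rewrite gt0_muley ?lte_fin.
Qed.

Lemma Rintegral_image (g : V -> R) : nu.-integrable [set: V] (EFin \o g) ->
  \int[mu]_(x in D) g (phi x) = k * \int[nu]_x g x.
Proof.
move=> ig; have mg : measurable_fun setT (EFin \o g) := measurable_int _ ig.
rewrite /Rintegral.
have -> : (\int[mu]_(x in D) (g (phi x))%:E = k%:E * \int[nu]_x (g x)%:E)%E.
  rewrite -[X in integral _ _ X]/((EFin \o g) \o phi).
  rewrite integralE [X in (_ * X)%E]integralE muleBr//; last first.
    rewrite fin_num_adde_defl// fin_numN; apply: integrable_fin_num => //.
    exact: integrable_funeneg.
  congr (_ - _)%E.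
    rewrite funepos_comp.
    exact: (ge0_integral_image (measurable_funepos mg) (fun=> funepos_ge0 _ _)).
  rewrite funeneg_comp.
  exact: (ge0_integral_image (measurable_funeneg mg) (fun=> funeneg_ge0 _ _)).
by rewrite fineM//; exact: integrable_fin_num.
Qed.

End ImageMeasure.

(** The measure structure of [pushforward] depends on a proof of measurability,
    which cannot be inferred from the function alone. *)
Definition image_measure d1 d2 (U : measurableType d1) (V : measurableType d2)
    (R : realType) (phi : U -> V) (mphi : measurable_fun [set: U] phi)
    (mu : {measure set U -> \bar R}) : {measure set V -> \bar R} :=
  measure_function_pushforward__canonical__measure_function_Measure mu mphi.

(** Restricting to the whole space leaves the measure unchanged and turns the
    bound on its total mass into the structure of a finite measure. *)
Lemma finite_measure_of d (T : measurableType d) (R : realType)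
    (m : {measure set T -> \bar R}) : (m [set: T] < +oo)%E ->
  exists m' : {finite_measure set T -> \bar R}, m' = m :> (set T -> \bar R).
Proof.
move=> moo; exists (mfrestr measurableT moo); apply/funext => A.
by rewrite /= /mfrestr /mrestr setIT.
Qed.

(** Normalizing a measure of mass 1 leaves it unchanged; the Dirac mass is only
    the default value used by normalization for degenerate masses. *)
Lemma probability_of d (T : measurableType d) (R : realType)
    (m : {measure set T -> \bar R}) : (m [set: T] = 1)%E ->
  exists Q : probability T R, Q = m :> (set T -> \bar R).
Proof.
move=> m1; exists (mnormalize m (dirac point)); apply/funext => A.
by rewrite /= /mnormalize/= m1 onee_eq0/= invr1 mule1.
Qed.

Lemma conditional_law d1 d2 (U : measurableType d1) (V : measurableType d2)
    (R : realType) (P : probability U R) (D : set U) (phi : U -> V) :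
    measurable D -> measurable_fun [set: U] phi -> (0 < P D)%E ->
  exists Q : probability V R, forall A, measurable A ->
    P (D `&` phi @^-1` A) = ((fine (P D))%:E * Q A)%E.
Proof.
move=> mD mphi PD0; have PDfin : P D \is a fin_num by rewrite fin_num_measure.
have fPD0 : 0 < fine (P D) by rewrite fine_gt0// PD0 ltey_eq PDfin.
have fPDV : 0 <= (fine (P D))^-1 by rewrite invr_ge0 ltW.
pose nu := mscale (NngNum fPDV) (image_measure mphi (mrestr P mD)).
have [|Q QE] := @probability_of _ _ _ nu.
  rewrite /nu /= /mscale /= /pushforward /mrestr preimage_setT setTI.
  by rewrite -(fineK PDfin) -EFinM mulVf// gt_eqF.
exists Q => A mA; rewrite QE /nu /= /mscale/= /pushforward /mrestr.
by rewrite muleA -EFinM mulfV ?gt_eqF// mul1e setIC.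
Qed.

(** * Splitting two laws along their overlap *)

(** The positive part of Q1 - Q0: the difference restricted to [H], where it is
    nonnegative, is a measure and not merely a charge. *)
Lemma excess_measure d (T : measurableType d) (R : realType)
    (Q1 Q0 : {finite_measure set T -> \bar R}) (H : set T) :
    measurable H ->
    (forall A, measurable A -> A `<=` H -> (Q0 A <= Q1 A)%E) ->
  exists J : {measure set T -> \bar R}, forall A, measurable A ->
    (Q1 (A `&` H) = J A + Q0 (A `&` H))%E.
Proof.
move=> mH Q01.
pose nu := cadd (charge_of_finite_measure Q1)
                (cscale (-1) (charge_of_finite_measure Q0)).
have nuE A : nu A = (Q1 A - Q0 A)%E.
  by rewrite /nu /cadd /= /cscale /= mulN1e.
have J_ge0 A : (0 <= crestr0 nu mH A)%E.
  rewrite /crestr0; case: ifPn => // /[1!inE] mA; rewrite /crestr.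
  have mAH := measurableI _ _ mA mH.
  rewrite nuE sube_ge0 ?fin_num_measure//; apply: Q01 => // x [].
exists (measure_of_charge (crestr0 nu mH) J_ge0) => A mA.
have mAH := measurableI _ _ mA mH.
rewrite [X in (X + _)%E](_ : _ = nu (A `&` H)) ?nuE ?subeK ?fin_num_measure//.
by rewrite /= /measure_of_charge /crestr0 mem_set//; exact: nuE.
Qed.

(** The overlap m of Q1 and Q0 equals Q0 on [H] and Q1 off [H]; it has mass
    t = 1 - (Q1 H - Q0 H).  Taking B = s m with s t = 1 - c gives the common
    part its prescribed mass, and Q_z - B = (1 - s) Q_z + s (Q_z - m) is a
    combination of measures, since Q_z - m is an excess measure. *)
Lemma overlap_decomposition d (T : measurableType d) (R : realType)
    (Q1 Q0 : probability T R) (H : set T) (c : R) :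
    measurable H ->
    (forall A, measurable A -> A `<=` H -> (Q0 A <= Q1 A)%E) ->
    (forall A, measurable A -> A `<=` ~` H -> (Q1 A <= Q0 A)%E) ->
    (Q1 H <= Q0 H + c%:E)%E -> c <= 1 ->
  exists A1 A0 B : {finite_measure set T -> \bar R},
    [/\ forall E, measurable E -> Q1 E = (A1 E + B E)%E,
        forall E, measurable E -> Q0 E = (A0 E + B E)%E,
        A1 [set: T] = c%:E & A0 [set: T] = c%:E].
Proof.
move=> mH Q01 Q10 tvc c1.
have mHC := measurableC mH.
have [J1 J1E] := excess_measure mH Q01.
have [J0 J0E] := excess_measure mHC Q10.
pose q1 := fine (Q1 H); pose q0 := fine (Q0 H).
have Q1H : Q1 H = q1%:E by rewrite fineK// fin_num_measure.
have Q0H : Q0 H = q0%:E by rewrite fineK// fin_num_measure.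
have q01 : q0 <= q1 by rewrite -lee_fin -Q1H -Q0H; exact: Q01.
have q10 : q1 <= q0 + c by rewrite -lee_fin EFinD -Q1H -Q0H.
have q0_ge0 : 0 <= q0 by exact: fine_ge0.
have q1_le1 : q1 <= 1 by rewrite -lee_fin -Q1H probability_le1.
pose t := 1 - (q1 - q0).
have t_ge0 : 0 <= t by rewrite /t; lra.
have [s [s0 s1 st]] : exists s, [/\ 0 <= s, 0 <= 1 - s & s * t = 1 - c].
  (* For t = 0 the hypotheses force c = 1, and s = 0 works. *)
  exists ((1 - c) / t); have [t0|t0] := eqVneq t 0.
    by rewrite t0 invr0 mulr0 subr0; split => //; rewrite /t in t0; lra.
  have tp : 0 < t by rewrite lt_neqAle eq_sym t0.
  rewrite divfK//; split => //; first by rewrite divr_ge0// subr_ge0.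
  by rewrite subr_ge0 ler_pdivrMr// mul1r /t; lra.
pose m := measure_add (mrestr Q0 mH) (mrestr Q1 mHC).
pose mix (Q J : {measure set T -> \bar R}) : {measure set T -> \bar R} :=
  measure_add (mscale (NngNum s1) Q) (mscale (NngNum s0) J).
have m_E E : m E = (Q0 (E `&` H) + Q1 (E `&` ~` H))%E.
  exact: measure_addE.
have mix_E Q J E : mix Q J E = ((1 - s)%:E * Q E + s%:E * J E)%E.
  exact: measure_addE.
have QH (Q : probability T R) E : measurable E ->
    Q E = (Q (E `&` H) + Q (E `&` ~` H))%E.
  move=> mE; rewrite -measureU//; last 3 first.
  - exact: measurableI.
  - exact: measurableI.
  - by rewrite setIACA setICr setI0.
  by rewrite -setIUr setUv setIT.
have mJ1 E : measurable E -> Q1 E = (J1 E + m E)%E.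
  move=> mE; rewrite m_E.
  by rewrite addeA -J1E// -QH.
have mJ0 E : measurable E -> Q0 E = (J0 E + m E)%E.
  move=> mE; rewrite m_E.
  by rewrite addeCA -J0E// -QH.
have mixE (Q J : {measure set T -> \bar R}) E : Q E = (J E + m E)%E ->
    Q E = (mix Q J E + mscale (NngNum s0) m E)%E.
  move=> QE; rewrite mix_E [X in (_ + X)%E]/mscale/=.
  rewrite -addeA -ge0_muleDr// -QE -ge0_muleDl// ?lee_fin//.
  by rewrite -EFinD subrK mul1e.
have mT : m [set: T] = t%:E.
  rewrite m_E !setTI.
  by rewrite probability_setC// Q1H Q0H -EFinB -EFinD /t; congr EFin; ring.
have BT : mscale (NngNum s0) m [set: T] = (1 - c)%:E.
  by rewrite -[LHS]/(s%:E * m [set: T])%E mT -EFinM st.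
have mixT (Q J : {measure set T -> \bar R}) : Q [set: T] = 1%E ->
    Q [set: T] = (J [set: T] + m [set: T])%E -> mix Q J [set: T] = c%:E.
  move=> Q1T /mixE; rewrite Q1T BT.
  by case: (mix Q J setT) => //= r [] rE; congr EFin; lra.
have Bfin : (mscale (NngNum s0) m [set: T] < +oo)%E by rewrite BT ltry.
have mixT1 := mixT Q1 J1 (probability_setT Q1) (mJ1 _ measurableT).
have mixT0 := mixT Q0 J0 (probability_setT Q0) (mJ0 _ measurableT).
have [B BE] := finite_measure_of Bfin.
have [|A1 A1E] := @finite_measure_of _ _ _ (mix Q1 J1).
  by rewrite mixT1 ltry.
have [|A0 A0E] := @finite_measure_of _ _ _ (mix Q0 J0).
  by rewrite mixT0 ltry.
exists A1, A0, B; rewrite A1E A0E BE; split => // E mE.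
- exact/mixE/mJ1.
- exact/mixE/mJ0.
Qed.

(** * Total variation in terms of densities *)

Section Density.
Context (R : realType) (d : measure_display) (S : measurableType d).
Variable muR : {sigma_finite_measure set S -> \bar R}.
Variable muY : {finite_measure set R -> \bar R}.

Let slice (t : bool) (A : set (S * R * bool)) : set (S * R) :=
  [set x | A (x, t)].

Let mslice t A : measurable A -> measurable (slice t A).
Proof.
exact: measurable_preimage (pair2_measurable t).
Qed.

(** Integration against the product of [muR], [muY] and the counting measure on
    {0, 1}. *)
Definition density_integral (A : set (S * R * bool)) (g : S * R * bool -> R) :=
  (\sum_(t : bool) \int[muR \x muY]_(x in [set x | A (x, t)]) (g (x, t))%:E)%E.

Let mslice_fun (g : S * R * bool -> R) t D :
  measurable_fun setT g -> measurable_fun D (fun x => (g (x, t))%:E).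
Proof.
move=> mg; apply/measurable_EFinP; apply: measurable_funTS.
exact: (measurableT_comp mg (pair2_measurable t)).
Qed.

Lemma density_integral_ge0 A (g : S * R * bool -> R) : (forall x, 0 <= g x) ->
  (0 <= density_integral A g)%E.
Proof.
by move=> g0; apply: sume_ge0 => t _; apply: integral_ge0 => x _; rewrite lee_fin.
Qed.

Lemma le_density_integral A (g h : S * R * bool -> R) : measurable A ->
  measurable_fun setT g -> measurable_fun setT h ->
  (forall x, 0 <= g x) -> (forall x, A x -> g x <= h x) ->
  (density_integral A g <= density_integral A h)%E.
Proof.
move=> mA mg mh g0 gh; apply: lee_sum => t _; apply: ge0_le_integral.
- exact: mslice.
- by move=> x _; rewrite lee_fin.
- exact: mslice_fun.
- exact: mslice_fun.
- by move=> x Ax; rewrite lee_fin gh.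
Qed.

Lemma density_integralD A (g h k : S * R * bool -> R) : measurable A ->
  measurable_fun setT g -> measurable_fun setT h ->
  (forall x, 0 <= g x) -> (forall x, 0 <= h x) ->
  (forall x, A x -> k x = g x + h x) ->
  (density_integral A k = density_integral A g + density_integral A h)%E.
Proof.
move=> mA mg mh g0 h0 kE; rewrite -big_split; apply: eq_bigr => t _.
rewrite /= -ge0_integralD//.
- by apply: eq_integral => x /[!inE] Ax; rewrite kE.
- exact: mslice.
- by move=> x _; rewrite lee_fin.
- exact: mslice_fun.
- by move=> x _; rewrite lee_fin.
- exact: mslice_fun.
Qed.

Lemma density_integralUC A (g : S * R * bool -> R) : measurable A ->
  measurable_fun setT g -> (forall x, 0 <= g x) ->
  (density_integral [set: _] g =
   density_integral A g + density_integral (~` A) g)%E.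
Proof.
move=> mA mg g0; rewrite -big_split; apply: eq_bigr => t _ /=.
rewrite -ge0_integral_setU//.
- congr integral; apply/seteqP; split => //= x _.
  by have [|] := pselect (A (x, t)); [left|right].
- exact: mslice.
- exact: (mslice t (measurableC mA)).
- exact: mslice_fun.
- by move=> x _; rewrite lee_fin.
- by rewrite disj_set2E; apply/eqP/seteqP; split => // x [].
Qed.

(** Tonelli identifies the iterated integral with the integral against the
    product measure, in which the laws of X are expressed. *)
Lemma TV_density_integral (f1 f0 : S * R * bool -> R) :
  measurable_fun setT f1 -> measurable_fun setT f0 ->
  TV muR muY f1 f0 =
  2^-1 * fine (density_integral [set: _] (fun x => `|f1 x - f0 x|)).
Proof.
move=> mf1 mf0; rewrite /TV; congr (_ * fine _); apply: eq_bigr => t _.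
have mabs : measurable_fun [set: S * R] (fun x => `|f1 (x, t) - f0 (x, t)|%:E).
  apply: (mslice_fun (g := fun x => `|f1 x - f0 x|)).
  by apply: measurableT_comp => //; exact: measurable_funB.
rewrite [RHS](@fubini_tonelli2 _ _ _ _ _ muR muY
  (fun x => `|f1 (x, t) - f0 (x, t)|%:E))//.
Qed.

(** On H = {f0 <= f1} the integral of |f1 - f0| is Q1 H - Q0 H, and off [H] it
    is Q0 (~H) - Q1 (~H).  These are equal as both laws have mass 1, so half of
    their sum is Q1 H - Q0 H. *)
Lemma TV_overlap_set (Q1 Q0 : probability (S * R * bool)%type R)
    (f1 f0 : S * R * bool -> R) :
    measurable_fun setT f1 -> measurable_fun setT f0 ->
    (forall x, 0 <= f1 x) -> (forall x, 0 <= f0 x) ->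
    (forall A, measurable A -> Q1 A = density_integral A f1) ->
    (forall A, measurable A -> Q0 A = density_integral A f0) ->
  exists H : set (S * R * bool), [/\ measurable H,
    forall A, measurable A -> A `<=` H -> (Q0 A <= Q1 A)%E,
    forall A, measurable A -> A `<=` ~` H -> (Q1 A <= Q0 A)%E &
    Q1 H = (Q0 H + (TV muR muY f1 f0)%:E)%E].
Proof.
move=> mf1 mf0 f1_ge0 f0_ge0 Q1E Q0E.
pose H := [set x | f0 x <= f1 x].
have mH : measurable H.
  by rewrite -[H]setTI; exact: measurable_fun_le.
exists H; split=> //.
- move=> A mA AH; rewrite Q1E// Q0E//; apply: le_density_integral => //.
- move=> A mA AH; rewrite Q1E// Q0E//; apply: le_density_integral => // x /AH.
  by move=> /= /negP; rewrite -ltNge => /ltW.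
have mHC := measurableC mH.
pose k x := `|f1 x - f0 x|.
have mk : measurable_fun setT k.
  by apply: measurableT_comp => //; exact: measurable_funB.
have k_ge0 x : 0 <= k x by exact: normr_ge0.
have aE : Q1 H = (Q0 H + density_integral H k)%E.
  rewrite Q1E// Q0E//; apply: density_integralD => // x /= Hx.
  by rewrite /k ger0_norm ?subr_ge0// addrC subrK.
have bE : Q0 (~` H) = (Q1 (~` H) + density_integral (~` H) k)%E.
  rewrite Q1E// Q0E//; apply: density_integralD => // x /= /negP.
  by rewrite -ltNge => Hx; rewrite /k distrC gtr0_norm ?subr_gt0// addrC subrK.
rewrite TV_density_integral// (density_integralUC mH)//.
move: bE; rewrite !probability_setC//.
have := density_integral_ge0 H k_ge0; have := density_integral_ge0 (~` H) k_ge0.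
move: aE.
have : Q1 H \is a fin_num by rewrite fin_num_measure.
have : Q0 H \is a fin_num by rewrite fin_num_measure.
case: (Q1 H) => // q1; case: (Q0 H) => // q0 _ _.
case: (density_integral H _) => // a; case: (density_integral _ _) => // b.
move=> [aE] _ _ [bE]; congr EFin => /=; lra.
Qed.

End Density.

(** * Measurements under a treatment or an instrument value *)

Section TreatmentArms.
Context {S R : Type}.
Implicit Types (t z : bool) (w : latent S R).

Definition X_cf t w : S * R * bool := (R_cf t w, Y_cf t w, T_cf t w).

(** The measurements that would be observed if Z were set to [z]. *)
Definition X_under z w : S * R * bool := X_cf (Tstar_cf z w) w.

Lemma X_underE z w t : Tstar_cf z w = t -> X_under z w = X_cf t w.
Proof. by rewrite /X_under => ->. Qed.

Lemma obsE w : obs w = (X_under (Z_lat w) w, Z_lat w).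
Proof. by []. Qed.

Lemma X_under_off_compliers w : (Tstar_cf false w <= Tstar_cf true w)%O ->
  ~ compliers w -> X_under true w = X_under false w.
Proof.
rewrite /compliers /mkset => Tle /negP; rewrite lt_neqAle Tle andbT negbK => /eqP E.
by rewrite (X_underE (erefl _)) (X_underE E).
Qed.

Lemma Y_cf_compliers t w : compliers w -> Y_cf t w = (X_under t w).1.2.
Proof. by move: w => [[w [[] []]] z] // _; case: t. Qed.

End TreatmentArms.

Section Measurability.
Context {R : realType} {d : measure_display} {S : measurableType d}.
Implicit Types (t z : bool) (w : latent S R).

Lemma measurable_at d' (V : measurableType d') t :
  measurable_fun [set: V * V] (at_ t).
Proof. by case: t; [exact: measurable_snd|exact: measurable_fst]. Qed.

Lemma measurable_Z : measurable_fun [set: latent S R] Z_lat.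
Proof. exact: measurable_snd. Qed.

Lemma measurable_Tstar z : measurable_fun [set: latent S R] (Tstar_cf z).
Proof.
exact: (measurableT_comp (measurable_at z) (measurableT_comp measurable_snd
  measurable_fst)).
Qed.

Lemma measurable_Y_cf t : measurable_fun [set: latent S R] (Y_cf t : _ -> R).
Proof.
exact: (measurableT_comp (measurable_at t) (measurableT_comp measurable_snd
  (measurableT_comp measurable_fst
  (measurableT_comp measurable_fst measurable_fst)))).
Qed.

Lemma measurable_R_cf t : measurable_fun [set: latent S R] (R_cf t : _ -> S).
Proof.
exact: (measurableT_comp (measurable_at t) (measurableT_comp measurable_fst
  (measurableT_comp measurable_fst
  (measurableT_comp measurable_fst measurable_fst)))).
Qed.

Lemma measurable_T_cf t : measurable_fun [set: latent S R] (T_cf t).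
Proof.
exact: (measurableT_comp (measurable_at t) (measurableT_comp measurable_snd
  (measurableT_comp measurable_fst measurable_fst))).
Qed.

Lemma measurable_X_cf t : measurable_fun [set: latent S R] (X_cf t).
Proof.
apply: measurable_fun_pair; last exact: measurable_T_cf.
apply: measurable_fun_pair; first exact: measurable_R_cf.
exact: measurable_Y_cf.
Qed.

Lemma measurable_X_under z : measurable_fun [set: latent S R] (X_under z).
Proof.
rewrite (_ : X_under z = fun w => if Tstar_cf z w then X_cf true w
  else X_cf false w); last first.
  by apply/funext => w; rewrite /X_under; case: (Tstar_cf z w).
apply: measurable_fun_ifT; first exact: measurable_Tstar.
  exact: measurable_X_cf.
exact: measurable_X_cf.
Qed.

Lemma measurable_compliers : measurable (compliers : set (latent S R)).
Proof.
rewrite (_ : compliers = (Tstar_cf false @^-1` [set false]) `&`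
   (Tstar_cf true @^-1` [set true])); last first.
  by apply/seteqP; split => -[[w [[] []]] z] //= [].
by apply: measurableI; apply: measurable_preimage => //; exact: measurable_Tstar.
Qed.

End Measurability.

(** * Consequences of the assumptions for the observed law *)

Section Forward.
Context (R : realType) (d : measure_display) (S : measurableType d).
Variables (Pst : probability (latent S R) R) (P : probability (observed S R) R).
Hypotheses (HA : condition_A Pst) (HP : induces Pst P).
Variables (p : bool -> R) (Q : bool -> probability (S * R * bool)%type R).
Hypothesis p_gt0 : forall z, 0 < p z.
Hypothesis PE : forall z (A : set (S * R * bool)), measurable A ->
  P (Z_obs @^-1` [set z] `&` fst @^-1` A) = ((p z)%:E * Q z A)%E.

(** Independence is assumed for one t at a time, never for both potential
    measurements jointly; splitting according to the value t of T*_z leaves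
    events about a single X_t and (T*_0, T*_1). *)
Lemma independent_X_under z (A : set (S * R * bool)) : measurable A ->
  (Pst (Z_lat @^-1` [set z] `&` X_under z @^-1` A) =
   Pst (Z_lat @^-1` [set z]) * Pst (X_under z @^-1` A))%E.
Proof.
move=> mA; have [ind _ _] := HA.
pose F t := Tstar_cf z @^-1` [set t] `&` X_cf t @^-1` A : set (latent S R).
have mF t : measurable (F t).
  apply: measurableI; apply: measurable_preimage => //; first exact: measurable_Tstar.
  exact: measurable_X_cf.
have mZ : measurable (Z_lat @^-1` [set z] : set (latent S R)).
  by apply: measurable_preimage => //; exact: measurable_Z.
have F_disj : F true `&` F false = set0.
  apply/seteqP; split => // w [[E _] [E' _]].
  by have := etrans (esym (E : Tstar_cf z w = true)) (E' : Tstar_cf z w = false).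
have FE : X_under z @^-1` A = F true `|` F false.
  apply/seteqP; split => w.
    by rewrite /preimage /mkset => Xw; case E : (Tstar_cf z w); [left|right];
      split => //; rewrite /preimage /mkset /= -(X_underE E).
  by move=> [] [E Xw];
    rewrite /preimage /mkset (X_underE (E : Tstar_cf z w = _)).
have indF t : (Pst (Z_lat @^-1` [set z] `&` F t) =
    Pst (Z_lat @^-1` [set z]) * Pst (F t))%E.
  (* Reads T*_z and X_t off the tuple whose independence of Z is assumed. *)
  pose sel (v : S * bool * R * bool * bool) := if z then v.2 else v.1.2.
  pose x (v : S * bool * R * bool * bool) :=
    (v.1.1.1.1, v.1.1.2, v.1.1.1.2).
  have msel : measurable_fun setT sel.
    rewrite /sel; case: (z); first exact: measurable_snd.
    exact: (measurableT_comp measurable_snd measurable_fst).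
  have mff := measurableT_comp (@measurable_fst _ _ (S * bool * R)%type bool)
    (@measurable_fst _ _ _ bool).
  have mfff := measurableT_comp (@measurable_fst _ _ (S * bool)%type R) mff.
  have mx : measurable_fun setT x.
    apply: measurable_fun_pair; last exact: (measurableT_comp measurable_snd mfff).
    apply: measurable_fun_pair; first exact: (measurableT_comp measurable_fst mfff).
    exact: (measurableT_comp measurable_snd mff).
  have := ind t [set z] (sel @^-1` [set t] `&` x @^-1` A) _ _.
  rewrite (_ : _ @^-1` (sel @^-1` [set t] `&` x @^-1` A) = F t); last first.
    by apply/seteqP; split => w; rewrite /F /sel; case: (z).
  apply => //.
  by apply: measurableI; apply: measurable_preimage.
rewrite FE setIUr measureU; last 3 first.
- exact: measurableI.
- exact: measurableI.
- by rewrite setIACA F_disj setI0.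
rewrite [X in (_ = _ * X)%E]measureU//.
by rewrite ge0_muleDr//; congr (_ + _)%E; exact: indF.
Qed.

(** On Z = z the observed measurements are those under [z], and by independence
    the conditioning on Z = z can be dropped. *)
Lemma law_X_under z (A : set (S * R * bool)) : measurable A ->
  Pst (X_under z @^-1` A) = Q z A.
Proof.
move=> mA.
have mZ : measurable (Z_obs @^-1` [set z] : set (observed S R)).
  by apply: measurable_preimage => //; exact: measurable_snd.
have PZ : Pst (Z_lat @^-1` [set z]) = (p z)%:E.
  have := HP mZ; rewrite /pushforward => <-.
  have := PE z measurableT; rewrite probability_setT mule1 => <-.
  by rewrite preimage_setT setIT.
have : P (Z_obs @^-1` [set z] `&` fst @^-1` A) =
    Pst (Z_lat @^-1` [set z] `&` X_under z @^-1` A).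
  rewrite HP; last first.
    by apply: measurableI => //; apply: measurable_preimage => //;
      exact: measurable_fst.
  rewrite /pushforward; congr (Pst _); apply/seteqP.
  by split => w /= [<-].
rewrite PE// independent_X_under// PZ => /eqP.
by rewrite eq_le !lee_pmul2l ?lte_fin// -eq_le => /eqP ->.
Qed.

Let mX z (A : set (S * R * bool)) : measurable A ->
  measurable (X_under z @^-1` A : set (latent S R)).
Proof. by move=> mA; apply: measurable_preimage => //; exact: measurable_X_under. Qed.

Lemma defiers_negligible :
  exists N, [/\ measurable N, Pst N = 0 & forall w : latent S R,
    ~ N w -> (Tstar_cf false w <= Tstar_cf true w)%O].
Proof.
have [_ [N [mN N0 sub]] _] := HA.
by exists N; split => // w Nw; apply: contrapT => Tw; apply: Nw; exact: sub.
Qed.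

(** An outcome lying in the event under z = 1 but not under z = 0 needs
    T*_0 <> T*_1, which off a null set happens only for compliers. *)
Lemma law_gap_le_compliers (H : set (S * R * bool)) : measurable H ->
  (Q true H <= Q false H + Pst compliers)%E.
Proof.
move=> mH; rewrite -!law_X_under//.
have [N [mN N0 NT]] := defiers_negligible.
have mC := @measurable_compliers R d S.
have mU := measurableU _ _ (measurableU _ _ (mX false mH) mC) mN.
apply: (@le_trans _ _ (Pst (X_under false @^-1` H `|` compliers `|` N))).
  apply: le_measure; rewrite ?inE//; first exact: mX.
  move=> w Hw; have [|Nw] := pselect (N w); first by right.
  have [|Cw] := pselect (compliers w); first by left; right.
  by left; left; rewrite /preimage /mkset -(X_under_off_compliers (NT _ Nw) Cw).
apply: le_trans (measureU2 Pst (measurableU _ _ (mX false mH) mC) mN) _.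
rewrite [X in (_ + X <= _)%E](_ : _ = 0%E)// adde0.
exact: (measureU2 Pst (mX false mH) mC).
Qed.

Let y (x : S * R * bool) : R := x.1.2.

Let my : measurable_fun setT y.
Proof. exact: (measurableT_comp measurable_snd measurable_fst). Qed.

Hypothesis HY : P.-integrable [set: observed S R] (EFin \o Y_obs).

Lemma integrable_Y z : (Q z).-integrable [set: S * R * bool] (EFin \o y).
Proof.
have mZ : measurable (Z_obs @^-1` [set z] : set (observed S R)).
  by apply: measurable_preimage => //; exact: measurable_snd.
have Yz : P.-integrable (Z_obs @^-1` [set z]) (EFin \o (y \o fst)).
  exact: (integrableS measurableT mZ _ HY).
exact: (integrable_of_image mZ (@measurable_fst _ _ _ _) (ltW (p_gt0 z)) (PE z)
  (p_gt0 z) my Yz).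
Qed.

Lemma cond_mean_Y z :
  cond_mean P (Z_obs @^-1` [set z]) Y_obs = \int[Q z]_x y x.
Proof.
have mZ : measurable (Z_obs @^-1` [set z] : set (observed S R)).
  by apply: measurable_preimage => //; exact: measurable_snd.
rewrite /cond_mean; have -> : fine (P (Z_obs @^-1` [set z])) = p z.
  have := PE z measurableT; rewrite probability_setT mule1.
  by rewrite preimage_setT setIT => ->.
rewrite (_ : \int[P]_(w in _) _ = p z * \int[Q z]_x y x).
  by rewrite mulrC mulKf// gt_eqF.
exact: (Rintegral_image mZ (@measurable_fst _ _ _ _) (ltW (p_gt0 z)) (PE z)
  (integrable_Y z)).
Qed.

Let X_image z (A : set (S * R * bool)) : measurable A ->
  (Pst ([set: latent S R] `&` X_under z @^-1` A) = 1%:E * Q z A)%E.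
Proof. by move=> mA; rewrite setTI law_X_under// mul1e. Qed.

Lemma integrable_Y_under z :
  Pst.-integrable [set: latent S R] (EFin \o (y \o X_under z)).
Proof.
exact: (integrable_image measurableT (measurable_X_under z) ler01 (@X_image z)
  (integrable_Y z)).
Qed.

Lemma Rintegral_Y_under z :
  \int[Pst]_w y (X_under z w) = \int[Q z]_x y x.
Proof.
by rewrite (Rintegral_image measurableT (measurable_X_under z) ler01
  (@X_image z) (integrable_Y z)) mul1r.
Qed.

(** On compliers Y_t coincides with Y under z = t, whose law Q_t has a finite
    mean; Y_t itself may fail to be integrable off the compliers. *)
Lemma integrable_complier_Y t :
  Pst.-integrable compliers (EFin \o (Y_cf t : latent S R -> R)).
Proof.
have mC := @measurable_compliers R d S.
apply: (@eq_integrable _ _ _ _ _ mC (EFin \o (y \o X_under t))).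
  by move=> w /[!inE] Cw; congr EFin; exact/esym/Y_cf_compliers.
exact: (integrableS measurableT mC _ (integrable_Y_under t)).
Qed.

(** The means of Y under z = 1 and z = 0 have the same contribution from
    non-compliers, which cancels in the difference. *)
Lemma Rintegral_compliers :
  \int[Pst]_(w in compliers) Y_cf true w
    - \int[Pst]_(w in compliers) Y_cf false w = DeltaEY P.
Proof.
have mC := @measurable_compliers R d S.
have mCC := measurableC mC.
rewrite /DeltaEY !cond_mean_Y -!Rintegral_Y_under.
have split_Y z : \int[Pst]_w y (X_under z w) =
    \int[Pst]_(w in compliers) Y_cf z w +
    \int[Pst]_(w in ~` compliers) y (X_under z w).
  rewrite -[in LHS](setvU compliers) setUC Rintegral_setU//; last 2 first.
  - by rewrite setUC setvU; exact: integrable_Y_under.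
  - by rewrite disj_set2E setICr.
  congr (_ + _); apply: eq_Rintegral => w /[!inE] Cw.
  exact/esym/Y_cf_compliers.
rewrite !split_Y opprD addrACA.
rewrite (_ : \int[Pst]_(w in ~` compliers) y (X_under true w) =
  \int[Pst]_(w in ~` compliers) y (X_under false w)) ?subrr ?addr0//.
rewrite /Rintegral; congr fine.
have my_under z : measurable_fun (~` compliers)
    (fun w : latent S R => (y (X_under z w))%:E).
  apply: measurable_funTS; exact: (measurable_int _ (integrable_Y_under z)).
apply: ae_eq_integral => //.
have [N [mN N0 NT]] := defiers_negligible.
exists N; split => // w; apply: contra_notP => Nw Cw.
by rewrite (X_under_off_compliers (NT _ Nw) Cw).
Qed.

End Forward.

(** * The LATE as a difference of means of densities *)

(** The derivative for sigma-finite measures is used as density because it is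
    nonnegative and finite everywhere rather than almost everywhere.  The
    change of variables for an integrand of varying sign goes through the
    derivative for charges, which agrees with it up to a null set. *)
Lemma density_of_law (R : realType) (muY : {finite_measure set R -> \bar R})
    (nu : probability R R) :
    nu `<< muY -> nu.-integrable [set: R] (EFin \o id) ->
  exists f : R -> R,
    density muY f /\ \int[muY]_y (y * f y) = \int[nu]_y y.
Proof.
move=> dom inu.
pose g := Radon_Nikodym_SigmaFinite.f nu muY.
have g_fin := Radon_Nikodym_SigmaFinite.f_fin_num dom.
have ig := Radon_Nikodym_SigmaFinite.f_integrable dom.
pose f y := fine (g y).
have fE y : (f y)%:E = g y by rewrite fineK.
have mf : measurable_fun setT f.
  by apply/measurable_EFinP; apply: eq_measurable_fun (measurable_int _ ig) => y _;
    rewrite /= fE.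
have yfE : (fun y => (y * f y)%:E) = (fun y => (y%:E * g y)%E).
  by apply/funext => y; rewrite EFinM fE.
have iyf : muY.-integrable [set: R] (fun y => (y * f y)%:E).
  rewrite yfE.
  have iabs : muY.-integrable [set: R] ((abse \o (EFin \o id)) \* g)%E.
    apply: (Radon_Nikodym_SigmaFinite.integrableM dom) => // [y|].
      exact: abse_ge0.
    exact: integrable_abse.
  apply: le_integrable iabs => //.
    by apply: emeasurable_funM; [exact/measurable_EFinP|exact: measurable_int ig].
  by move=> y _; rewrite /= !abseM /= normr_id.
exists f; split; first split => //.
- by move=> y; rewrite fine_ge0// Radon_Nikodym_SigmaFinite.f_ge0.
- under eq_integral do rewrite fE.
  rewrite -(Radon_Nikodym_SigmaFinite.f_integral dom)//.
  exact: probability_setT.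
rewrite /Rintegral yfE -(Radon_Nikodym_change_of_variables dom measurableT inu).
congr fine; apply: ae_eq_integral => //.
- by rewrite -yfE; exact: (measurable_int _ iyf).
- apply: emeasurable_funM => //; exact/measurable_EFinP.
- apply: ae_eqe_mul2l.
  exact: ae_eq_Radon_Nikodym_SigmaFinite.
Qed.

(** The conditional law of Y_t given the compliers inherits a density from the
    law of Y_t, because conditioning preserves null sets. *)
Lemma LATE_in_Theta (R : realType) (d : measure_display) (S : measurableType d)
    (muY : {finite_measure set R -> \bar R})
    (Pst : probability (latent S R) R) :
    dominated_outcomes muY Pst -> (0 < Pst compliers)%E ->
    (forall t,
       Pst.-integrable compliers (EFin \o (Y_cf t : latent S R -> R))) ->
  Theta muY ((\int[Pst]_(w in compliers) Y_cf true w
              - \int[Pst]_(w in compliers) Y_cf false w)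
             / fine (Pst compliers)).
Proof.
move=> dom C0 iY; have mC := @measurable_compliers R d S.
set c := fine _.
have c0 : 0 < c by rewrite fine_gt0// C0 ltey_eq fin_num_measure.
have law t : exists f, density muY f /\
    \int[Pst]_(w in compliers) Y_cf t w / c = \int[muY]_y (y * f y).
  have [nu nuE] := conditional_law mC (measurable_Y_cf t) C0.
  have inu := integrable_of_image mC (measurable_Y_cf t) (ltW c0) nuE c0
    (@measurable_id _ _ setT) (iY t).
  have dnu : nu `<< muY.
    apply/null_content_dominatesP => A mA A0.
    have : (c%:E * nu A = 0)%E.
      rewrite -nuE//; apply/eqP; rewrite -measure_le0.
      have /null_content_dominatesP/(_ _ mA A0) := dom t.
      rewrite /pushforward => <-; apply: measureIr => //.
      exact: measurable_preimage (measurable_Y_cf t) mA.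
    by move/eqP; rewrite mule_eq0 eqe gt_eqF//= => /eqP.
  have [f [df fE]] := density_of_law dnu inu.
  exists f; split => //; rewrite fE.
  rewrite (Rintegral_image mC (measurable_Y_cf t) (ltW c0) nuE inu).
  by rewrite mulrC mulKf// gt_eqF.
have [f1 [df1 f1E]] := law true; have [f0 [df0 f0E]] := law false.
by exists f1, f0; split => //; rewrite mulrBl f1E f0E.
Qed.

(** * A model with prescribed complier and never-taker laws *)

Section Coupling.
Context (R : realType) (d : measure_display) (V : measurableType d).

(** The normalized product measure.  For c = 0 the factor is 0 and both marginals
    vanish, so no case distinction is needed when the coupling is used. *)
Lemma coupling (A1 A0 : {finite_measure set V -> \bar R}) (c : R) :
    0 <= c -> A1 [set: V] = c%:E -> A0 [set: V] = c%:E ->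
  exists G : {measure set (V * V) -> \bar R},
    forall t E, measurable E ->
      G (at_ t @^-1` E) = (if t then A1 E else A0 E).
Proof.
move=> c0 A1T A0T; have ci : 0 <= c^-1 by rewrite invr_ge0.
exists (mscale (NngNum ci) (A0 \x A1)%E) => t E mE.
rewrite -[LHS]/(c^-1%:E * (A0 \x A1) (at_ t @^-1` E))%E.
have cancel (A : {finite_measure set V -> \bar R}) : A [set: V] = c%:E ->
    (c^-1%:E * (c%:E * A E) = A E)%E.
  move=> AT; have [cz|cnz] := eqVneq c 0.
    rewrite cz !mul0e mule0; apply/esym/eqP; rewrite -measure_le0.
    apply: (@le_trans _ _ (A [set: V])); last by rewrite AT cz.
    by apply: le_measure; rewrite ?inE.
  by rewrite muleA -EFinM mulVf// mul1e.
case: t.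
  rewrite (_ : at_ true @^-1` E = [set: V] `*` E); last first.
    by apply/seteqP; split => -[x0 x1] //= [].
  by rewrite product_measure1E// [X in (_ * (X * _))%E]A0T cancel.
rewrite (_ : at_ false @^-1` E = E `*` [set: V]); last first.
  by apply/seteqP; split => -[x0 x1] //= [].
by rewrite product_measure1E// [X in (_ * (_ * X))%E]A1T [X in (_ * X)%E]muleC cancel.
Qed.

End Coupling.

Section LatentLaw.
Context {R : realType} {d : measure_display} {S : measurableType d}.
Local Notation V := (S * R * bool)%type.

(** A pair (X_0, X_1) together with the type [k] (complier or never-taker) and
    the instrument value [z]: T*_0 is always 0 and T*_1 is [k]. *)
Definition latent_of (k z : bool) (x : V * V) : latent S R :=
  ((x.1.1.1, x.2.1.1), (x.1.1.2, x.2.1.2), (x.1.2, x.2.2), (false, k), z).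

Lemma X_cf_latent_of t k z x : X_cf t (latent_of k z x) = at_ t x.
Proof. by case: x => -[[r0 y0] t0] [[r1 y1] t1]; case: t. Qed.

Lemma X_under_latent_of z' k z x :
  X_under z' (latent_of k z x) = at_ (z' && k) x.
Proof.
by rewrite /X_under X_cf_latent_of; congr (at_ _ x).
Qed.

Lemma obs_latent_of k z x : obs (latent_of k z x) = (at_ (z && k) x, z).
Proof. by rewrite obsE X_under_latent_of. Qed.

Lemma measurable_latent_of k z : measurable_fun [set: V * V] (latent_of k z).
Proof.
have mf := @measurable_fst _ _ V V; have ms := @measurable_snd _ _ V V.
have mV1 := @measurable_fst _ _ (S * R)%type bool.
have mV2 := @measurable_snd _ _ (S * R)%type bool.
have mS := @measurable_fst _ _ S R; have mR := @measurable_snd _ _ S R.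
have pairs d' (W : measurableType d') (g : V -> W) : measurable_fun setT g ->
    measurable_fun setT (fun x : V * V => (g x.1, g x.2)).
  by move=> mg; apply: measurable_fun_pair;
    [exact: (measurableT_comp mg mf)|exact: (measurableT_comp mg ms)].
apply: measurable_fun_pair => //; apply: measurable_fun_pair => //.
apply: measurable_fun_pair; last exact: (pairs _ _ snd mV2).
apply: measurable_fun_pair.
  exact: (pairs _ _ (fun v => v.1.1) (measurableT_comp mS mV1)).
exact: (pairs _ _ (fun v => v.1.2) (measurableT_comp mR mV1)).
Qed.

(** [p] is the law of Z and [G k] the law of (X_0, X_1) on type [k]; the
    construction makes Z independent of all the rest. *)
Variables (p : bool -> R) (G : bool -> {measure set (V * V) -> \bar R}).
Hypotheses (p_ge0 : forall z, 0 <= p z) (p1 : p true + p false = 1).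
Hypothesis G1 : (G true [set: _] + G false [set: _] = 1)%E.

Let arm z : {measure set (latent S R) -> \bar R} :=
  measure_add (image_measure (measurable_latent_of true z) (G true))
              (image_measure (measurable_latent_of false z) (G false)).

Lemma latent_law : exists Pst : probability (latent S R) R,
  forall E, Pst E = (\sum_(z : bool) (p z)%:E *
    \sum_(k : bool) G k (latent_of k z @^-1` E))%E.
Proof.
pose m : {measure set (latent S R) -> \bar R} :=
  measure_add (mscale (NngNum (p_ge0 true)) (arm true))
              (mscale (NngNum (p_ge0 false)) (arm false)).
have armE z E : arm z E = (\sum_(k : bool) G k (latent_of k z @^-1` E))%E.
  by rewrite big_bool; exact: measure_addE.
have mE E : m E = (\sum_(z : bool) (p z)%:E *
    \sum_(k : bool) G k (latent_of k z @^-1` E))%E.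
  by rewrite big_bool -!armE; exact: measure_addE.
have [|Pst PstE] := @probability_of _ _ _ m.
  by rewrite mE !big_bool/= !preimage_setT G1 !mule1 -EFinD p1.
by exists Pst => E; rewrite PstE mE.
Qed.

End LatentLaw.

Section SharpModel.
Context (R : realType) (d : measure_display) (S : measurableType d).
Local Notation V := (S * R * bool)%type.
Variable muY : {finite_measure set R -> \bar R}.
Variable P : probability (observed S R) R.
Variables (p : bool -> R) (Q : bool -> probability V R).
Hypotheses (p_gt0 : forall z, 0 < p z) (p1 : p true + p false = 1).
Hypothesis PE : forall z (A : set V), measurable A ->
  P (Z_obs @^-1` [set z] `&` fst @^-1` A) = ((p z)%:E * Q z A)%E.
Hypothesis Q_dom : forall z (A : set R), measurable A -> muY A = 0%E ->
  Q z [set x | A x.1.2] = 0%E.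
Variables (A1 A0 B : {finite_measure set V -> \bar R}) (c : R).
Hypotheses (c_ge0 : 0 <= c)
  (Q1E : forall E, measurable E -> Q true E = (A1 E + B E)%E)
  (Q0E : forall E, measurable E -> Q false E = (A0 E + B E)%E)
  (A1T : A1 [set: V] = c%:E) (A0T : A0 [set: V] = c%:E).

Let A t := if t then A1 else A0.

Let QE t (E : set V) : measurable E -> Q t E = (A t E + B E)%E.
Proof. by move=> mE; case: t; [exact: Q1E|exact: Q0E]. Qed.

(** Compliers follow the coupling of A0 and A1, never-takers the law B on the
    diagonal.  Under z the measurements are then distributed as A_z + B = Q_z,
    which is the law to be induced, and each X_t is distributed as A_t + B. *)
Lemma sharp_model : exists Pst : probability (latent S R) R,
  [/\ dominated_outcomes muY Pst, condition_A Pst, induces Pst P &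
      Pst compliers = c%:E].
Proof.
have [Gc GcE] := coupling c_ge0 A1T A0T.
have mdiag : measurable_fun [set: V] (fun x : V => (x, x)).
  by apply: measurable_fun_pair => //; exact: measurable_id.
pose G k : {measure set (V * V) -> \bar R} :=
  if k then Gc else image_measure mdiag B.
have GtE t (E : set V) : measurable E -> G true (at_ t @^-1` E) = A t E.
  by move=> mE; rewrite /= GcE//; case: t.
have GfE t (E : set V) : G false (at_ t @^-1` E) = B E.
  by rewrite /= /pushforward; congr (B _); case: t.
have GT t : (G true [set: _] + G false [set: _] = Q t [set: _])%E.
  by rewrite QE//; congr (_ + _)%E; exact: (GtE t _ measurableT).
have G1 : (G true [set: _] + G false [set: _] = 1)%E.
  by rewrite (GT true) probability_setT.
have [Pst PstE] := latent_law (fun z => ltW (p_gt0 z)) p1 G1.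
(* The probability of an event that does not involve Z. *)
pose M (F : set (latent S R)) :=
  (\sum_(k : bool) G k (latent_of k true @^-1` F))%E.
have PstM F : (forall k, latent_of k false @^-1` F = latent_of k true @^-1` F) ->
    Pst F = M F.
  move=> FE; rewrite PstE (eq_bigr (fun z => (p z)%:E * M F)%E); last first.
    by move=> [] _; congr (_ * _)%E; apply: eq_bigr => k _; rewrite ?FE.
  by rewrite big_bool /= -ge0_muleDl ?lee_fin ?ltW// -EFinD p1 mul1e.
exists Pst; split.
- move=> t; apply/null_content_dominatesP => E mE E0.
  rewrite /pushforward PstM; last first.
    by move=> k; apply/seteqP; split => x; case: t.
  have mE' : measurable ([set x | E x.1.2] : set V).
    by apply: (measurable_preimage (g := fun x : V => x.1.2)) => //;
      exact: (measurableT_comp measurable_snd measurable_fst).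
  rewrite /M big_bool.
  have preE k : latent_of k true @^-1` (Y_cf t @^-1` E) =
      at_ t @^-1` [set x | E x.1.2].
    by apply/seteqP; split => x; case: t.
  rewrite !preE GtE// GfE; apply: etrans (Q_dom t mE E0); exact/esym/QE.
- split.
  + move=> t U W mU mW; rewrite PstE.
    (* The tuple X does not involve Z, so both sides factor over z. *)
    set X := (fun w : latent S R => _).
    have XE k z : latent_of k z @^-1` (X @^-1` W) =
        latent_of k true @^-1` (X @^-1` W).
      by apply/seteqP; split => x.
    have ZE k z : latent_of k z @^-1` (Z_lat @^-1` U) =
        if z \in U then [set: V * V] else set0.
      case: ifPn => [/set_mem|/negP] Uz; apply/seteqP; split => x //= Ux.
      by apply: Uz; exact: mem_set.
    rewrite (PstM (X @^-1` W)) => [|k]; last by rewrite XE.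
    rewrite PstE.
    rewrite ge0_sume_distrl; last first.
      move=> z _; apply: mule_ge0; first by rewrite lee_fin ltW.
      exact: sume_ge0.
    apply: eq_bigr => z _; rewrite -muleA; congr (_ * _)%E.
    under eq_bigr do rewrite preimage_setI XE ZE.
    under [in RHS]eq_bigr do rewrite ZE.
    case: ifPn => _.
      rewrite [X in (_ = X * _)%E](_ : _ = 1%E) ?mul1e; last first.
        by rewrite big_bool.
      by apply: eq_bigr => k _; rewrite setTI.
    rewrite [X in (_ = X * _)%E]big1 ?mul0e; last by move=> k _; rewrite measure0.
    by rewrite big1// => k _; rewrite set0I measure0.
  + exists [set w | ~~ (Tstar_cf false w <= Tstar_cf true w)%O]; split.
    * rewrite (_ : [set _ | _] =
        (Tstar_cf false @^-1` [set true]) `&` (Tstar_cf true @^-1` [set false])).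
        by apply: measurableI; apply: measurable_preimage => //;
          exact: measurable_Tstar.
      by apply/seteqP; split => -[[w [[] []]] z] //= [].
    * by rewrite PstE big1// => z _; rewrite big1 ?mule0// => k _;
        rewrite [X in G k X](_ : _ = set0) ?measure0//;
        apply/seteqP; split => x.
    * by move=> w /negP.
  + have -> : Pst (Z_lat @^-1` [set false]) = (p false)%:E.
      rewrite PstE big_bool/=.
      rewrite [X in (_ * X + _)%E]big1 ?mule0 ?add0e; last first.
        move=> k _; rewrite [X in G k X](_ : _ = set0) ?measure0//.
        by apply/seteqP; split.
      rewrite [X in (_ * X)%E](_ : _ = 1%E) ?mule1// -G1 big_bool.
      by congr (_ + _)%E; congr (G _ _); apply/seteqP; split.
    rewrite lte_fin p_gt0 lte_fin -p1 ltrDr.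
    exact: p_gt0.
- move=> E mE.
  have mZ z : measurable (Z_obs @^-1` [set z] : set (observed S R)).
    by apply: measurable_preimage => //; exact: measurable_snd.
  pose Ez z : set V := [set x | E (x, z)].
  have mEz z : measurable (Ez z).
    exact: (measurable_preimage (g := fun x => (x, z)) (pair2_measurable z) mE).
  have mfE z : measurable (fst @^-1` Ez z : set (observed S R)).
    by apply: measurable_preimage => //; exact: measurable_fst.
  have EE : E = (Z_obs @^-1` [set true] `&` fst @^-1` Ez true) `|`
                (Z_obs @^-1` [set false] `&` fst @^-1` Ez false).
    apply/seteqP; split => -[x z]; last by move=> [] [/= ->].
    by case: z => ?; [left|right].
  rewrite [in LHS]EE measureU; last 3 first.
  - exact: measurableI.
  - exact: measurableI.
  - apply/seteqP; split => // w [[Z1 _] [Z0 _]].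
    by have := etrans (esym (Z1 : Z_obs w = true)) (Z0 : Z_obs w = false).
  rewrite [LHS](_ : _ = \sum_(z : bool) (p z)%:E * Q z (Ez z))%E; last first.
    by rewrite big_bool; congr (_ + _)%E; exact: PE.
  rewrite /pushforward PstE; apply: eq_bigr => z _; congr (_ * _)%E.
  rewrite QE// big_bool; congr (_ + _)%E.
    rewrite -(GtE z)//; congr (G _ _); apply/funext => x.
    by rewrite /preimage /mkset obs_latent_of andbT.
  rewrite -(GfE false); congr (G _ _); apply/funext => x.
  by rewrite /preimage /mkset obs_latent_of andbF.
- rewrite PstM => [|k]; last by apply/seteqP; split.
  rewrite /M big_bool -[RHS]adde0; congr (_ + _)%E.
    rewrite -A1T -(GtE true)//; congr (G _ _).
    by apply/seteqP; split.
  rewrite [X in G _ X](_ : _ = set0) ?measure0//.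
  by apply/seteqP; split.
Qed.

End SharpModel.

(** * The sharp identified set *)

Section SharpBounds.
Context (R : realType) (d : measure_display) (S : measurableType d).
Variables (muR : {sigma_finite_measure set S -> \bar R})
  (muY : {finite_measure set R -> \bar R}).
Variable P : probability (observed S R) R.
Hypotheses (HZ : (0 < P (Z_obs @^-1` [set false]) < 1)%E)
  (HY : P.-integrable [set: observed S R] (EFin \o Y_obs))
  (Hdom : pushforward P (RY_obs : observed S R -> S * R)
            `<< (muR \x muY)%E).
Variable f : bool -> S * R * bool -> R.
Hypothesis Hf : forall z : bool, is_cond_density muR muY P z (f z).

Let tv := TV muR muY (f true) (f false).
Let p z := fine (P (Z_obs @^-1` [set z])).

Let mZ z : measurable (Z_obs @^-1` [set z] : set (observed S R)).
Proof. exact: measurable_preimage measurable_snd _. Qed.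

Let Pz z : P (Z_obs @^-1` [set z]) = (p z)%:E.
Proof. by rewrite fineK// fin_num_measure. Qed.

Let p1 : p true + p false = 1.
Proof.
have ZC : Z_obs @^-1` [set true] = ~` (Z_obs @^-1` [set false] : set (observed S R)).
  by apply/seteqP; split => -[x []] // nz; exfalso; exact: nz.
apply: EFin_inj; rewrite EFinD -!Pz ZC probability_setC// subeK//.
by rewrite fin_num_measure.
Qed.

Let p_gt0 z : 0 < p z.
Proof.
move: HZ; rewrite Pz !lte_fin => /andP[p0 pl1].
by case: z => //; rewrite -(ltrD2r (p false)) p1 add0r.
Qed.

(** The bounds and the model are stated for the conditional laws of X given Z
    as measures; densities only enter through the total variation. *)
Lemma conditional_laws : exists Q : bool -> probability (S * R * bool)%type R,
  forall z (A : set (S * R * bool)), measurable A ->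
    P (Z_obs @^-1` [set z] `&` fst @^-1` A) = ((p z)%:E * Q z A)%E.
Proof.
have /choice[Q PQ] : forall z, exists Qz : probability (S * R * bool)%type R,
    forall A : set (S * R * bool), measurable A ->
    P (Z_obs @^-1` [set z] `&` fst @^-1` A) = ((p z)%:E * Qz A)%E.
  move=> z; have Pz0 : (0 < P (Z_obs @^-1` [set z]))%E by rewrite Pz lte_fin.
  exact: (conditional_law (mZ z) (@measurable_fst _ _ _ _) Pz0).
by exists Q.
Qed.

Section WithConditionalLaws.
Variable Q : bool -> probability (S * R * bool)%type R.
Hypothesis PE : forall z (A : set (S * R * bool)), measurable A ->
    P (Z_obs @^-1` [set z] `&` fst @^-1` A) = ((p z)%:E * Q z A)%E.

Let QE z A : measurable A -> Q z A = density_integral muR muY A (f z).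
Proof.
move=> mA; have [_ _ fE] := Hf z.
have : ((p z)%:E * Q z A = (p z)%:E * density_integral muR muY A (f z))%E.
  rewrite -PE// -Pz -fE//; congr (P _).
  by apply/seteqP; split => -[x z'] [].
by move/eqP; rewrite eq_le !lee_pmul2l ?lte_fin// -eq_le => /eqP.
Qed.

Let Q_dom z (A : set R) : measurable A -> muY A = 0%E ->
  Q z [set x | A x.1.2] = 0%E.
Proof.
move=> mA A0.
have mA' : measurable ([set x | A x.1.2] : set (S * R * bool)).
  apply: (measurable_preimage (g := fun x : S * R * bool => x.1.2)) => //.
  exact: (measurableT_comp measurable_snd measurable_fst).
have PA0 : P (RY_obs @^-1` ([set: S] `*` A)) = 0%E.
  have /null_content_dominatesP/(_ ([set: S] `*` A)) := Hdom; apply.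
    exact: measurableX.
  have mST : measurable [set: S] by exact: measurableT.
  by rewrite [LHS](product_measure1E muR muY mST mA)
    [X in (_ * X)%E](_ : _ = 0%E) ?mule0.
have : ((p z)%:E * Q z [set x | A x.1.2] = 0)%E.
  apply/eqP; rewrite -PE// -measure_le0 -PA0.
  apply: le_measure; rewrite ?inE.
  - by apply: measurableI => //; exact: measurable_preimage measurable_fst mA'.
  - apply: measurable_preimage; last exact: measurableX.
    exact: (measurableT_comp measurable_fst measurable_fst).
  - by move=> x [_ Ax]; split.
by move/eqP; rewrite mule_eq0 eqe gt_eqF//= => /eqP.
Qed.

Let overlap : exists H : set (S * R * bool), [/\ measurable H,
    forall A, measurable A -> A `<=` H -> (Q false A <= Q true A)%E,
    forall A, measurable A -> A `<=` ~` H -> (Q true A <= Q false A)%E &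
    Q true H = (Q false H + tv%:E)%E].
Proof.
have [mf1 f1_ge0 _] := Hf true; have [mf0 f0_ge0 _] := Hf false.
exact: TV_overlap_set (QE true) (QE false).
Qed.

Let D (w : latent S R) : R := Y_cf true w - Y_cf false w.

Lemma complier_share_bounds (Pst : probability (latent S R) R) :
  condition_A Pst -> induces Pst P -> tv <= fine (Pst compliers) <= 1.
Proof.
move=> HA HP; have [H [mH _ _ tvE]] := overlap.
have mC := @measurable_compliers R d S.
have Cfin : Pst compliers \is a fin_num by rewrite fin_num_measure.
apply/andP; split; last first.
  by rewrite -lee_fin fineK// probability_le1.
have := law_gap_le_compliers HA HP p_gt0 PE mH.
by rewrite tvE leeD2lE ?fin_num_measure// -lee_fin fineK.
Qed.

(** Being valid for every admissible model, it also gives the LATE of the model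
    constructed for sharpness. *)
Lemma LATE_value (Pst : probability (latent S R) R) :
    dominated_outcomes muY Pst -> condition_A Pst -> induces Pst P ->
    (0 < Pst compliers)%E ->
  [/\ Pst.-integrable compliers (EFin \o D),
      cond_mean Pst compliers D = DeltaEY P / fine (Pst compliers) &
      Theta muY (DeltaEY P / fine (Pst compliers))].
Proof.
move=> dom HA HP C0; have mC := @measurable_compliers R d S.
have iY := integrable_complier_Y HA HP p_gt0 PE HY.
rewrite -(Rintegral_compliers HA HP p_gt0 PE HY); split.
- apply: eq_integrable (integrableB mC (iY true) (iY false)) => //.
- by rewrite /cond_mean /D RintegralB.
- exact: LATE_in_Theta.
Qed.

Lemma sharp_model_exists c : tv <= c <= 1 -> 0 <= c ->
  exists Pst : probability (latent S R) R,
    [/\ dominated_outcomes muY Pst, condition_A Pst, induces Pst P &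
        Pst compliers = c%:E].
Proof.
move=> /andP[tvc c1] c0; have [H [mH H1 H0 tvE]] := overlap.
have [|A1 [A0 [B [Q1E Q0E A1T A0T]]]] :=
    overlap_decomposition mH H1 H0 _ c1.
  by rewrite tvE leeD2lE ?fin_num_measure// lee_fin.
exact: (sharp_model p_gt0 p1 PE Q_dom c0 Q1E Q0E A1T A0T).
Qed.

Lemma TV_range : 0 <= tv <= 1.
Proof.
have [H [mH H1 _ tvE]] := overlap; apply/andP; split.
  have := H1 _ mH (@subset_refl _ _).
  by rewrite tvE -[X in (X <= _)%E]adde0 leeD2lE ?fin_num_measure// lee_fin.
have Q0H : (0 <= Q false H)%E by [].
have : (Q true H <= 1)%E by rewrite probability_le1.
by rewrite tvE -lee_fin; apply: le_trans; rewrite leeDr.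
Qed.

End WithConditionalLaws.

(** For TV = 0 the complier probability may be 0, and then the LATE is
    unrestricted within Theta. *)
Lemma identified_set_TV0 : tv = 0 -> identified_set muY P = Theta muY.
Proof.
move=> tv0; have [Q PE] := conditional_laws.
apply/seteqP; split => [theta []//|theta Th]; split => //.
have [||Pst [dom HA HP C0]] := @sharp_model_exists Q PE 0.
- by rewrite tv0 lexx ler01.
- by [].
by exists Pst; split => //; split; rewrite C0 ?ltxx.
Qed.

Lemma TV_gt0_le1 : tv <> 0 -> 0 < tv /\ tv <= 1.
Proof.
move=> /eqP tvn0; have [Q PE] := conditional_laws.
by have /andP[tv_ge0 ->] := TV_range PE; rewrite lt_neqAle eq_sym tvn0.
Qed.

Lemma identified_setE : tv <> 0 -> identified_set muY P =
  [set theta | exists c, tv <= c <= 1 /\ theta = DeltaEY P / c].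
Proof.
move=> tvn0; have [Q PE] := conditional_laws.
have [tv_gt0 _] := TV_gt0_le1 tvn0.
apply/seteqP; split => theta.
  move=> [_ [Pst [dom HA HP [LATE _]]]].
  have cb := complier_share_bounds PE HA HP.
  have C0 : (0 < Pst compliers)%E.
    rewrite -(fineK (fin_num_measure Pst _ measurable_compliers)) lte_fin.
    by case/andP: cb => + _; exact: lt_le_trans.
  have [_ meanD _] := LATE_value PE dom HA HP C0.
  exists (fine (Pst compliers)); split => //; rewrite -meanD.
  exact: (LATE C0).2.
move=> [c [cb ->]]; have c0 : 0 < c by case/andP: cb => /(lt_le_trans tv_gt0).
have [Pst [dom HA HP Cc]] := sharp_model_exists PE cb (ltW c0).
have C0 : (0 < Pst compliers)%E by rewrite Cc lte_fin.
have [iD meanD ThD] := LATE_value PE dom HA HP C0.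
rewrite Cc/= in meanD ThD; split => //.
by exists Pst.
Qed.


End SharpBounds.

Theorem theorem9 (R : realType) (d : measure_display) (S : measurableType d)
  (muR : {sigma_finite_measure set S -> \bar R})
  (muY : {finite_measure set R -> \bar R})
  (P : probability (observed S R) R)
  (HZ : (0 < P (Z_obs @^-1` [set false]) < 1)%E)
  (HY : P.-integrable [set: observed S R] (EFin \o Y_obs))
  (Hdom : pushforward P (RY_obs : observed S R -> S * R)
            `<< (muR \x muY)%E)
  (f : bool -> S * R * bool -> R)
  (Hf : forall z : bool, is_cond_density muR muY P z (f z)) :
  let DE := DeltaEY P in
  let tv := TV muR muY (f true) (f false) in
  (tv = 0 -> identified_set muY P = Theta muY) /\
  (tv <> 0 ->
     [/\ 0 < DE ->
           identified_set muY P = [set theta | DE <= theta <= DE / tv],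
         DE = 0 ->
           identified_set muY P = [set 0] &
         DE < 0 ->
           identified_set muY P = [set theta | DE / tv <= theta <= DE]]).
Proof.
move=> DE tv; split; first exact: identified_set_TV0.
move=> tvn0; have idE := identified_setE HZ HY Hdom Hf tvn0.
have [tv_gt0 tv_le1] := TV_gt0_le1 HZ Hf tvn0.
rewrite idE -/DE -/tv; split => DE0; apply/seteqP; split => theta /=.
- move=> [c [/andP[tvc c1] ->]]; have c0 := lt_le_trans tv_gt0 tvc.
  rewrite ler_pdivlMr// ler_piMr ?(ltW DE0)//=.
  by rewrite ler_pM2l// lef_pV2.
  (* The complier probability that yields theta is DE / theta. *)
- move=> /andP[DEt tDE]; have t0 := lt_le_trans DE0 DEt.
  exists (DE / theta); split; last by rewrite invf_div mulrC divfK// gt_eqF.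
  rewrite ler_pdivrMr// mul1r DEt andbT ler_pdivlMr// mulrC.
  by rewrite -ler_pdivlMr.
- by move=> [c [_ ->]]; rewrite DE0 mul0r.
- by move=> ->; exists 1; rewrite DE0 mul0r lexx tv_le1.
- move=> [c [/andP[tvc c1] ->]]; have c0 := lt_le_trans tv_gt0 tvc.
  rewrite ler_nM2l// lef_pV2// tvc/=.
  by rewrite ler_pdivrMr// -[leLHS]mulr1 ler_nM2l.
- move=> /andP[tDE DEt]; have t0 := le_lt_trans DEt DE0.
  exists (DE / theta); split; last by rewrite invf_div mulrC divfK// lt_eqF.
  rewrite ler_ndivrMr// mul1r DEt andbT ler_ndivlMr// mulrC.
  by rewrite -ler_pdivrMr.
Qed.
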